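(* Let $n\ge2$ and let $M=(m_{kl})\in\mathbb{R}^{n\times n}$ be a real correlation matrix satisfying $|m_{kl}|<1$ for every $k\neq l$. Let $t=(t_1,\dots,t_n)\in\mathbb{R}^n$ with $t_j>0$ for every $j$, and let $T=\mathrm{D}(t)$. Define $$\mathcal{I}_t(M)=\{\beta\in\mathbb{R}^n:\ \beta_k(M\beta)_k=t_k\text{ for every }k\in\{1,\dots,n\}\},$$ and for each $\beta\in\mathcal{I}_t(M)$ let $$c_t(\beta)=\frac{\det T}{\det\bigl(T+\mathrm{D}(\beta)M\mathrm{D}(\beta)\bigr)}.$$ Then $c_t(\beta)>0$ for every $\beta\in\mathcal{I}_t(M)$, $$\sum_{\beta\in\mathcal{I}_t(M)}c_t(\beta)=1,\qquad\text{and}\qquad\sum_{\beta\in\mathcal{I}_t(M)}c_t(\beta)\,\beta\otimes\beta=T.$$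
   Context: A real correlation matrix is a real symmetric positive semidefinite matrix all of whose diagonal entries equal $1$. $\mathrm{D}(x)$ denotes the diagonal matrix with diagonal $x$, and $x\otimes y=xy^\top$. *)

(* Defs.v *)
From mathcomp Require Import all_boot all_order all_algebra.
From mathcomp Require Import all_classical all_reals.

Set Implicit Arguments.
Unset Strict Implicit.
Unset Printing Implicit Defensive.

Import Order.TTheory GRing.Theory Num.Theory.

Local Open Scope classical_set_scope.
Local Open Scope ring_scope.

(* Vectors of R^n are columns; [diag_mx] takes a row, hence the transpose. *)
Definition diag_cv (R : realType) (n : nat) (x : 'cV[R]_n) : 'M[R]_n :=
  diag_mx x^T.

Definition tensor (R : realType) (n : nat) (x y : 'cV[R]_n) : 'M[R]_n :=
  x *m y^T.

Definition psd (R : realType) (n : nat) (M : 'M[R]_n) : Prop :=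
  forall x : 'cV[R]_n, 0 <= (x^T *m M *m x) 0 0.

Definition correlation_matrix (R : realType) (n : nat) (M : 'M[R]_n) : Prop :=
  [/\ M \is symmetricmx, psd M & forall k, M k k = 1].

Definition inv_set (R : realType) (n : nat) (t : 'cV[R]_n) (M : 'M[R]_n) :
    set 'cV[R]_n :=
  [set b : 'cV[R]_n | forall k, b k 0 * (M *m b) k 0 = t k 0].

(* A sum [\sum_(b \in A) F b] is the sum over the [b] in [A] with [F b != 0]
   when there are finitely many of them, and 0 otherwise.  Hence if [weight t M]
   is positive on [inv_set t M] and sums to 1 there, [inv_set t M] is finite. *)
Definition weight (R : realType) (n : nat) (t : 'cV[R]_n) (M : 'M[R]_n)
    (b : 'cV[R]_n) : R :=
  \det (diag_cv t) / \det (diag_cv t + diag_cv b *m M *m diag_cv b).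

(* Main.v *)
Require Import Defs.
From mathcomp Require Import all_boot all_order all_fingroup all_algebra.
From mathcomp Require Import all_classical all_reals all_analysis.
From mathcomp Require Import ring lra.

(** Write T = D(t) and consider the kernel K(x, y) = det (T + D(x) M D(y)).
Expanding the determinant along principal minors,

  K(x, y) = sum over S of t^(complement of S) det(M_S) x^S y^S,

where x^S is the product of the x_k with k in S, so K is a diagonal bilinear
form in the 2^n square-free monomials ([det_kernel_mx]).  If p and q are two
distinct elements of I_t(M), then D(q)^-1 (p - q) is a non-zero vector killed
by T + D(p) M D(q), so K(p, q) = 0 ([det_kernel_mx_eq0]).  Thus the vectors of
square-free monomials at the points of I_t(M) are orthogonal for this form, and
K(p, p) = det T / c_t(p).  When I_t(M) contains 2^n points they form an
orthogonal basis, and the dual relation says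

  det(M_S) * (sum over p of c_t(p) p^S p^S') = t^S if S = S', and 0 otherwise

([complete_moments]).  The cases where S and S' have at most one element are the
two identities to prove.

If M is positive definite there is indeed a solution in each of the 2^n
orthants: up to signs it is a critical point of the coercive function
x^T M x / 2 - sum_k t_k ln x_k on the positive orthant ([orthant_solution]).

A singular M is reached as the limit of M + e I, with e > 0 tending to 0, along
an ultrafilter.  Let p_s(e) be the solution of the perturbed system in the
orthant s, and c_s(e) its weight.  If the system of M has a solution in s, it is
unique and p_s(e) converges to it, by monotonicity of the logarithmic gradient
([orthant_close]).  Otherwise c_s(e) tends to 0: if it had a positive limit,
p_s(e) would stay bounded and converge to a solution in s ([limit_solution]).
It remains to see that in this case also c_s(e) p_s(e)_k p_s(e)_l tends to 0.
This is where the entries of M off the diagonal have to be smaller than 1 in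
absolute value: the duality relation for S = S' = {k, l} then bounds
c_s(e) (p_s(e)_k p_s(e)_l)^2 uniformly in e, first for k <> l, then for k = l
through the equations of the system ([perturb_bounded]); and
(c p_k p_l)^2 = c * (c (p_k p_l)^2). *)

Set Implicit Arguments.
Unset Strict Implicit.
Unset Printing Implicit Defensive.

Import Order.TTheory GRing.Theory Num.Theory.
Import numFieldNormedType.Exports.

Local Open Scope classical_set_scope.
Local Open Scope ring_scope.

(** * Square-free monomials, principal minors and the kernel *)

Definition kernel_mx (R : realType) (n : nat) (t : 'cV[R]_n) (M : 'M[R]_n)
    (x y : 'cV[R]_n) : 'M[R]_n :=
  diag_cv t + diag_cv x *m M *m diag_cv y.

Lemma kernel_mxE (R : realType) (n : nat) (t : 'cV[R]_n) (M : 'M[R]_n)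
    (x y : 'cV[R]_n) i j :
  kernel_mx t M x y i j = t i 0 *+ (i == j) + x i 0 * M i j * y j 0.
Proof.
by rewrite /kernel_mx /diag_cv mul_diag_mx mul_mx_diag !mxE.
Qed.

Definition monom (R : comNzRingType) (n : nat) (x : 'cV[R]_n) (S : {set 'I_n}) : R :=
  \prod_(i in S) x i 0.

(** The principal minor det(M_S), as the part of the Leibniz expansion carried by
the permutations with support in S: this avoids reindexing a submatrix by the
ordinals below #|S|. *)
Definition pminor (R : comNzRingType) (n : nat) (M : 'M[R]_n) (S : {set 'I_n}) : R :=
  \sum_(s : {perm 'I_n} | perm_on S s) (-1) ^+ s * \prod_(i in S) M i (s i).

Lemma perm_on_notin (n : nat) (S : {set 'I_n}) (s : {perm 'I_n}) :
  ~~ perm_on S s -> exists2 i, i \notin S & s i != i.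
Proof.
by move=> /fintype.subsetPn[i]; rewrite inE => si iS; exists i.
Qed.

(** In the Leibniz expansion, each row contributes either its diagonal entry t_i
or its entry of D(x) M D(y).  When S is the set of rows of the second kind, only
the permutations fixing the complement of S survive, and they permute the
factors y_j with j in S. *)
Lemma det_kernel_mx (R : realType) (n : nat) (t : 'cV[R]_n) (M : 'M[R]_n)
    (x y : 'cV[R]_n) :
  \det (kernel_mx t M x y) =
  \sum_(S : {set 'I_n}) monom t (~: S) * pminor M S * monom x S * monom y S.
Proof.
have leibniz (s : {perm 'I_n}) :
    (-1) ^+ s * \prod_i kernel_mx t M x y i (s i) =
    \sum_(S : {set 'I_n}) (-1) ^+ s *
      \prod_i (if i \in S then x i 0 * M i (s i) * y (s i) 0
               else t i 0 *+ (i == s i)).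
  rewrite -mulr_sumr -bigA_distr; congr (_ * _).
  by apply: eq_bigr => i _; rewrite kernel_mxE addrC.
rewrite [LHS](eq_bigr _ (fun s _ => leibniz s)) exchange_big /=.
apply: eq_bigr => S _; rewrite /pminor (bigID (perm_on S)) /=.
rewrite [X in _ + X]big1 ?addr0; last first.
  move=> s /perm_on_notin[i iS si].
  by rewrite (bigD1 i) //= (negPf iS) eq_sym (negPf si) mulr0n mul0r mulr0.
rewrite mulr_sumr !mulr_suml; apply: eq_bigr => s sS.
rewrite (bigID (mem S)) /=.
rewrite (eq_bigr (fun i => x i 0 * M i (s i) * y (s i) 0)); last by move=> i ->.
rewrite [X in _ * (_ * X)](eq_bigr (fun i => t i 0)); last first.
  by move=> i iS; rewrite (negPf iS) (out_perm sS iS) eqxx mulr1n.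
rewrite !big_split /=.
have -> : \prod_(i in S) y (s i) 0 = monom y S.
  rewrite /monom [RHS](reindex_inj (@perm_inj _ s)) /=.
  by apply: eq_bigl => i; rewrite (perm_closed _ sS).
have -> : \prod_(i | i \notin S) t i 0 = monom t (~: S).
  by apply: eq_bigl => i; rewrite inE.
rewrite -/(monom x S); move: (_ ^+ s) => sg.
move: (monom x S) (monom y S) (monom t _) (\prod_(i in S) M _ _) => a b c d.
ring.
Qed.

Lemma monom0 (R : comNzRingType) (n : nat) (x : 'cV[R]_n) :
  monom x (finset.set0 : {set _}) = 1.
Proof. by rewrite /monom big_set0. Qed.

Lemma monom1 (R : comNzRingType) (n : nat) (x : 'cV[R]_n) (k : 'I_n) :
  monom x [set k]%SET = x k 0.
Proof. by rewrite /monom big_set1. Qed.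

Lemma monom2 (R : comNzRingType) (n : nat) (x : 'cV[R]_n) (k l : 'I_n) :
  k != l -> monom x [set k; l]%SET = x k 0 * x l 0.
Proof. by move=> kl; rewrite /monom big_setU1 ?inE //= big_set1. Qed.

Lemma pminor0 (R : comNzRingType) (n : nat) (M : 'M[R]_n) :
  pminor M (finset.set0 : {set _}) = 1.
Proof.
rewrite /pminor (big_pred1 1%g) => [|s /=].
  by rewrite odd_perm1 big_set0 mulr1.
by apply/idP/eqP => [/perm_on_id|->]; [rewrite cards0; apply | exact: perm_on1].
Qed.

Lemma pminor1 (R : comNzRingType) (n : nat) (M : 'M[R]_n) (k : 'I_n) :
  pminor M [set k]%SET = M k k.
Proof.
rewrite /pminor (big_pred1 1%g) => [|s /=].
  by rewrite odd_perm1 big_set1 perm1 mul1r.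
by apply/idP/eqP => [/perm_on_id|->]; [rewrite cards1; apply | exact: perm_on1].
Qed.

Lemma pminor2 (R : comNzRingType) (n : nat) (M : 'M[R]_n) (k l : 'I_n) :
  k != l -> pminor M [set k; l]%SET = M k k * M l l - M k l * M l k.
Proof.
move=> kl; have t1 : tperm k l != 1%g.
  by apply/eqP => /permP/(_ k)/eqP; rewrite tpermL perm1 eq_sym (negPf kl).
rewrite /pminor (bigD1 1%g) ?perm_on1 //= (big_pred1 (tperm k l)).
  rewrite odd_perm1 odd_tperm kl !big_setU1 ?inE //= !big_set1.
  by rewrite !perm1 tpermL tpermR expr0 expr1 mul1r mulN1r.
move=> s /=; apply/andP/eqP => [[sS s1]|->]; last first.
  split=> //; apply/fintype.subsetP => i; rewrite !inE.
  by case: tpermP => [->|->|]; rewrite ?eqxx ?orbT.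
have sout i : i != k -> i != l -> s i = i.
  by move=> ik il; apply: (out_perm sS); rewrite !inE negb_or ik il.
have sk : s k = l.
  have := perm_closed k sS; rewrite !inE eqxx => /orP[/eqP sk|/eqP //].
  case/eqP: s1; apply/permP => i; rewrite perm1.
  have [->//|ik] := eqVneq i k; have [->|il] := eqVneq i l; last exact: sout.
  have := perm_closed l sS; rewrite !inE eqxx orbT => /orP[|/eqP//].
  by rewrite -{1}sk (inj_eq perm_inj) eq_sym (negPf kl).
have sl : s l = k.
  have := perm_closed l sS; rewrite !inE eqxx orbT => /orP[/eqP//|].
  by rewrite -[X in _ == X]sk (inj_eq perm_inj) eq_sym (negPf kl).
by apply/permP => i; case: tpermP => [->|->|/eqP ik /eqP il] //; exact: sout.
Qed.

Lemma mulmx_colE (R : nzRingType) (n : nat) (M : 'M[R]_n) (b : 'cV[R]_n) k :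
  (M *m b) k 0 = \sum_l M k l * b l 0.
Proof. by rewrite mxE. Qed.

(** From p_k (M p)_k = t_k = q_k (M q)_k one gets
(D(p) M + D(M q)) (p - q) = 0, and T + D(p) M D(q) = (D(p) M + D(M q)) D(q):
the non-zero vector D(q)^-1 (p - q) is in its kernel. *)
Lemma det_kernel_mx_eq0 (R : realType) (n : nat) (t : 'cV[R]_n) (M : 'M[R]_n)
    (p q : 'cV[R]_n) :
  (forall k, t k 0 != 0) -> inv_set t M p -> inv_set t M q -> p != q ->
  \det (kernel_mx t M p q) = 0.
Proof.
move=> t0 pI qI pq.
have q0 k : q k 0 != 0.
  by apply: contra_neq (t0 k) => qk; rewrite -(qI k) qk mul0r.
apply/eqP; rewrite -det_tr; apply/det0P.
exists (\row_k ((p k 0 - q k 0) / q k 0)).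
  apply: contra_neq pq => /rowP v0; apply/colP => k; apply/eqP.
  move/eqP: (v0 k); rewrite !mxE mulf_eq0 invr_eq0 (negPf (q0 k)) orbF.
  by rewrite subr_eq0.
apply/rowP => i; rewrite !mxE.
rewrite (eq_bigr (fun j => p i 0 * (M i j * p j 0) - p i 0 * (M i j * q j 0) +
    (t i 0 * (p i 0 - q i 0) / q i 0) *+ (i == j))); last first.
  move=> j _; rewrite mxE [X in _ * X]mxE kernel_mxE; have qj := q0 j.
  case: (eqVneq i j) => [->|_]; rewrite ?mulr1n ?mulr0n.
    move: (p j 0) (q j 0) (t j 0) (M j j) qj => a b c d b0; by field.
  move: (p i 0) (p j 0) (q j 0) (M i j) qj => a b c d b0; by field.
rewrite big_split /= sumrB -!mulr_sumr -!mulmx_colE (pI i).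
rewrite (bigD1 i) //= big1 => [|j /negPf ji]; last by rewrite eq_sym ji.
have qi := q0 i; have := qI i; rewrite eqxx mulr1n addr0 => <-.
move: (p i 0) (q i 0) ((M *m q) i 0) qi => a b c b0; by field.
Qed.

(** Enumerating I turns A and B into square matrices, for which a right inverse
is a left inverse. *)
Lemma sum_mul1C (R : comUnitRingType) (I : finType) (A B : I -> I -> R) :
  (forall i j, \sum_k A i k * B k j = (i == j)%:R) ->
  forall i j, \sum_k B i k * A k j = (i == j)%:R.
Proof.
move=> AB i j.
pose mx (F : I -> I -> R) := \matrix_(a < #|I|, b < #|I|) F (enum_val a) (enum_val b).
have mxM F G a b : (mx F *m mx G) a b = \sum_k F (enum_val a) k * G k (enum_val b).
  rewrite mxE [RHS](reindex (@enum_val I I)) /=; last first.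
    by apply: onW_bij; exact: enum_val_bij.
  by apply: eq_bigr => k _; rewrite !mxE.
have /mulmx1C/matrixP/(_ (enum_rank i) (enum_rank j)) : mx A *m mx B = 1%:M.
  by apply/matrixP => a b; rewrite mxM AB mxE (inj_eq enum_val_inj).
by rewrite mxM mxE !enum_rankK (inj_eq enum_rank_inj).
Qed.

Lemma det_diag_cv (R : realType) (n : nat) (t : 'cV[R]_n) (S : {set 'I_n}) :
  \det (diag_cv t) = monom t (~: S) * monom t S.
Proof.
rewrite /diag_cv det_diag (bigID (mem S)) mulrC /monom /=.
by congr (_ * _); apply: eq_big => i; rewrite ?inE ?mxE.
Qed.

(** The matrix of the p^S, with rows indexed by the 2^n solutions and columns by
the subsets S, is square.  Orthogonality of the solutions gives a right inverse,
with entries t^(complement of S) det(M_S) p^S / K(p, p); that it is a left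
inverse as well is the claim. *)
Lemma complete_moments (R : realType) (n : nat) (t : 'cV[R]_n) (M : 'M[R]_n)
    (p : {set 'I_n} -> 'cV[R]_n) :
  (forall k, t k 0 != 0) -> injective p ->
  (forall s, inv_set t M (p s)) ->
  (forall s, \det (kernel_mx t M (p s) (p s)) != 0) ->
  forall S S', pminor M S *
    \sum_s weight t M (p s) * (monom (p s) S * monom (p s) S') =
    (S == S')%:R * monom t S.
Proof.
move=> t0 pinj pI d0 S S'.
pose d s := \det (kernel_mx t M (p s) (p s)).
have dual s s' : \sum_U monom (p s) U *
    (monom t (~: U) * pminor M U * monom (p s') U / d s') = (s == s')%:R.
  transitivity (\det (kernel_mx t M (p s) (p s')) / d s').
    rewrite det_kernel_mx mulr_suml; apply: eq_bigr => U _.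
    move: (monom t _) (monom (p s) U) (monom (p s') U) (pminor _ _) (d s')^-1.
    by move=> *; ring.
  case: (eqVneq s s') => [->|ss']; first by rewrite divff ?d0.
  by rewrite det_kernel_mx_eq0 ?mul0r// (inj_eq pinj).
rewrite -(sum_mul1C (A := fun s U => monom (p s) U) dual S S').
rewrite mulr_sumr mulr_suml; apply: eq_bigr => s _.
rewrite /weight (det_diag_cv _ S) -/(kernel_mx _ _ _ _) -/(d s).
move: (monom t (~: S)) (monom t S) (monom (p s) S) (monom (p s) S').
by move: (pminor M S) (d s)^-1 => *; ring.
Qed.

(** * Positivity of the weights *)

Lemma quadE (R : nzRingType) (n : nat) (A : 'M[R]_n) (x : 'cV[R]_n) :
  (x^T *m A *m x) 0 0 = \sum_k x k 0 * (A *m x) k 0.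
Proof. by rewrite -mulmxA mxE; apply: eq_bigr => k _; rewrite mxE. Qed.

Lemma sum_sqr_gt0 (R : realDomainType) (n : nat) (t x : 'cV[R]_n) :
  (forall k, 0 < t k 0) -> x != 0 -> 0 < \sum_k t k 0 * x k 0 ^+ 2.
Proof.
move=> t0 x0; have ge0 k : 0 <= t k 0 * x k 0 ^+ 2.
  by rewrite mulr_ge0 ?sqr_ge0 ?ltW.
rewrite lt_neqAle sumr_ge0 // andbT eq_sym.
apply: contra_neq x0 => /eqP; rewrite psumr_eq0 // => /allP x0.
apply/colP => k; have /implyP/(_ isT) := x0 k (mem_index_enum k).
by rewrite mxE mulf_eq0 gt_eqF //= sqrf_eq0 => /eqP.
Qed.

(** Along the segment from the identity to A the form stays positive definite, so
the determinant, a polynomial in the parameter, has no root there and keeps the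
sign it has at the identity. *)
Lemma posdef_det_gt0 (R : rcfType) (n : nat) (A : 'M[R]_n) :
  (forall x : 'cV[R]_n, x != 0 -> 0 < (x^T *m A *m x) 0 0) -> 0 < \det A.
Proof.
move=> A0; rewrite ltNge; apply/negP => dA.
pose B := \matrix_(i, j) (1%:M i j *: (1 - 'X) + A i j *: 'X) : 'M[{poly R}]_n.
have BE s : map_mx (horner_eval s) B = (1 - s)%:M + s *: A.
  apply/matrixP => i j; rewrite !mxE /horner_eval !hornerE mulr_natl.
  by rewrite [A i j * s]mulrC.
have dB s : (- \det B).[s] = - \det ((1 - s)%:M + s *: A).
  by rewrite -BE det_map_mx /horner_eval hornerE.
have [||s /andP[s0 s1]] := @poly_ivt _ (- \det B) 0 1; first exact: ler01.
  rewrite !dB subr0 subrr scale0r scale1r addr0 det1 raddf0 add0r.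
  by rewrite oppr_le0 ler01 oppr_ge0.
rewrite rootE dB oppr_eq0 => /det0P[v v0 vC].
have : (v *m ((1 - s)%:M + s *: A) *m v^T) 0 0 = 0 by rewrite vC mul0mx mxE.
rewrite mulmxDr mulmxDl mul_mx_scalar -scalemxAr -!scalemxAl !mxE => vv.
have v0' : v^T != 0 by rewrite trmx_eq0.
have := A0 _ v0'; rewrite trmxK mxE => Av.
have /sum_sqr_gt0/(_ v0') : forall k : 'I_n, 0 < (const_mx 1 : 'cV[R]_n) k 0.
  by move=> k; rewrite mxE.
rewrite (eq_bigr (fun k => v 0 k * v^T k 0)) => [vv0|k _]; last first.
  by rewrite !mxE mul1r expr2.
move: vv0 Av vv; set a := \sum_j _; set b := \sum_j _ => a0 b0 ab.
by have [sl|sg] := lerP s (1 / 2); nra.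
Qed.

Lemma weight_gt0 (R : realType) (n : nat) (t : 'cV[R]_n) (M : 'M[R]_n)
    (b : 'cV[R]_n) :
  psd M -> (forall k, 0 < t k 0) -> 0 < weight t M b.
Proof.
move=> Mpsd t0; apply: divr_gt0.
  rewrite (det_diag_cv _ finset.set0) monom0 mulr1.
  by apply: prodr_gt0 => k _.
apply: posdef_det_gt0 => x x0; rewrite mulmxDr mulmxDl mxE.
apply: ltr_wpDr.
  have := Mpsd (diag_cv b *m x).
  by rewrite trmx_mul [(diag_cv b)^T]tr_diag_mx !mulmxA.
rewrite quadE (eq_bigr (fun k => t k 0 * x k 0 ^+ 2)); first exact: sum_sqr_gt0.
by move=> k _; rewrite /diag_cv mul_diag_mx !mxE mulrCA expr2.
Qed.

(** * Limits along an ultrafilter, and minimisation *)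

Lemma ultra_bounded_cvg (R : realType) (T : Type) (U : set_system T) (u : T -> R)
    (B : R) : UltraFilter U ->
  (\forall m \near U, `|u m| <= B) -> exists l : R, u m @[m --> U] --> l.
Proof.
move=> UU uB.
have useg : (u @ U) `[- B, B]%classic.
  by apply: filterS uB => m /=; rewrite in_itv /= ler_norml.
have [l [_ ul]] := @segment_compact R (- B) B (u @ U) _ useg.
exists l => A lA.
have [//|nA] := in_ultra_setVsetC (u @^-1` A) UU.
by have [x [nAx Ax]] := ul (~` A) A nA lA; case: nAx.
Qed.

(** Continuity is asked along ultrafilters and coordinatewise, the form in which
it is used on a minimising sequence: coercivity bounds the sequence, whose
coordinates therefore converge along an ultrafilter, to a minimiser. *)
Lemma coercive_min (R : realType) (n : nat) (G : ('I_n -> R) -> R) (L : R) :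
  (forall U : set_system nat, UltraFilter U ->
     forall (y : nat -> 'I_n -> R) (z : 'I_n -> R),
     (forall k, y m k @[m --> U] --> z k) -> G (y m) @[m --> U] --> G z) ->
  (forall y, L <= G y) ->
  (forall C, exists B, forall y, G y <= C -> forall k, `|y k| <= B) ->
  exists y, forall z, G y <= G z.
Proof.
move=> Gcont GL Gco.
have Ginf : has_inf (range G).
  by split; [exists (G (fun=> 0)), (fun=> 0) | exists L => _ [y _ <-]].
pose I := inf (range G).
have GI y : I <= G y by apply: ge_inf; [exact: Ginf.2 | exists y].
have /choice[y yI] (m : nat) : exists y : 'I_n -> R, G y < I + m.+1%:R^-1.
  have e0 : 0 < m.+1%:R^-1 :> R by rewrite invr_gt0.
  by have [_ [y _ <-] yI] := inf_adherent e0 Ginf; exists y.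
have [U [UU oU]] := ultraFilterLemma (@eventually_filter).
have [B yB] := Gco (I + 1).
have /choice[z yz] k : exists z : R, y m k @[m --> U] --> z.
  apply: (@ultra_bounded_cvg _ _ _ _ B) => //; apply: nearW => m; apply: yB.
  by rewrite (le_trans (ltW (yI m))) // lerD2l invf_le1 // ler1n.
exists z; suff -> : G z = I by [].
apply: (@cvg_unique _ (@Rhausdorff R) (G (y m) @[m --> U])).
  exact: Gcont.
apply: (@squeeze_cvgr _ _ _ _ (fun=> I) (fun m => I + m.+1%:R^-1)).
- by apply: nearW => m; rewrite GI ltW.
- exact: cvg_cst.
- rewrite -[X in _ --> X]addr0; apply: cvgD; first exact: cvg_cst.
  by apply: cvg_trans (@cvg_harmonic R); apply: cvg_app.
Qed.

(** * A solution in each orthant for a positive definite matrix *)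

(** The first-order condition at the minimum u = 1 of
a (u - 1) + c (u - 1)^2 - t ln u. *)
Lemma tangent_slope (R : realType) (a c t : R) : 0 <= t ->
  (forall u, 0 < u -> t * ln u <= a * (u - 1) + c * (u - 1) ^+ 2) -> a = t.
Proof.
move=> t0 H.
have K u : 0 < u -> t * (u - 1) <= u * (a * (u - 1) + c * (u - 1) ^+ 2).
  move=> u0; have := H u u0; rewrite -(ler_pM2l u0); apply: le_trans.
  have lnu : 1 - u^-1 <= ln u.
    have := @le_ln1Dx R (u^-1 - 1); rewrite addrCA subrr addr0 lnV ?posrE //.
    have : 0 < u^-1 by rewrite invr_gt0.
    by move=> ui /(_ _); lra.
  have -> : t * (u - 1) = u * (t * (1 - u^-1)) by field; rewrite gt_eqF.
  by rewrite ler_pM2l // ler_wpM2l.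
suff D d : 0 < d -> d <= 1 / 2 -> `|a - t| <= d * (2 * `|c| + 2 * t).
  apply/eqP; rewrite -subr_eq0 -normr_eq0 eq_le normr_ge0 andbT.
  apply/ler_addgt0Pr => e e0; rewrite add0r.
  (* The choice d = e / q gives d <= 1/2 and d (2 |c| + 2 t) <= e. *)
  pose q := 2 * `|c| + 2 * t + 2 * e.
  have q0 : 0 < q by rewrite /q; have := normr_ge0 c; lra.
  have dq : 0 < e / q by rewrite divr_gt0.
  apply: le_trans (D _ dq _) _.
    by rewrite ler_pdivrMr // /q; have := normr_ge0 c; lra.
  rewrite mulrAC ler_pdivrMr // ler_pM2l // /q; lra.
move=> d0 d1.
have Kp := K (1 + d) ltac:(lra).
have Km := K (1 - d) ltac:(lra).
have {}Kp : t <= (1 + d) * (a + c * d) by rewrite -(ler_pM2l d0); nra.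
have {}Km : (1 - d) * (a - c * d) <= t by rewrite -(ler_pM2l d0); nra.
have td2 : 0 <= t * d * d by rewrite !mulr_ge0 // ltW.
have td3 : 0 <= t * d * (1 - 2 * d) by rewrite !mulr_ge0 ?(ltW d0) //; lra.
have {}Kp : t * (1 - d) <= a + c * d.
  by rewrite -(ler_pM2l (_ : 0 < 1 + d)); [lra | lra].
have {}Km : a - c * d <= t * (1 + 2 * d).
  by rewrite -(ler_pM2l (_ : 0 < 1 - d)); [lra | lra].
have cp : c * d <= `|c| * d by rewrite ler_pM2r // ler_norm.
have cc : 0 <= `|c| * d by rewrite mulr_ge0 // ltW.
have td : 0 <= t * d by rewrite mulr_ge0 // ltW.
by rewrite ler_norml; apply/andP; split; lra.
Qed.

Lemma cvg_sum (R : realType) (T : Type) (F : set_system T) (I : finType)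
    (u : I -> T -> R) (l : I -> R) : Filter F ->
  (forall i, u i m @[m --> F] --> l i) ->
  \sum_i u i m @[m --> F] --> \sum_i l i.
Proof. by move=> FF ul; apply: cvg_big => //; exact: add_continuous. Qed.

Lemma cvg_prodr (R : realType) (T : Type) (F : set_system T) (I : finType)
    (u : I -> T -> R) (l : I -> R) : Filter F ->
  (forall i, u i m @[m --> F] --> l i) ->
  \prod_i u i m @[m --> F] --> \prod_i l i.
Proof. by move=> FF ul; apply: cvg_big => //; exact: mul_continuous. Qed.

Section Minimisation.
Variables (R : realType) (n : nat) (M : 'M[R]_n) (t : 'cV[R]_n).

Definition expcv (y : 'I_n -> R) : 'cV[R]_n := \col_k expR (y k).

(** The function x^T M x / 2 - sum_k t_k ln x_k in the coordinates y = ln x, which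
range over the whole space instead of the positive orthant. *)
Definition potential (y : 'I_n -> R) : R :=
  2^-1 * \sum_k expcv y k 0 * (M *m expcv y) k 0 - \sum_k t k 0 * y k.

Lemma potential_cvg (U : set_system nat) : UltraFilter U ->
  forall (y : nat -> 'I_n -> R) (z : 'I_n -> R),
     (forall k, y m k @[m --> U] --> z k) ->
  potential (y m) @[m --> U] --> potential z.
Proof.
move=> UU y z yz.
have ez k : expcv (y m) k 0 @[m --> U] --> expcv z k 0.
  rewrite mxE; under eq_fun do rewrite mxE.
  by apply: continuous_cvg => //; exact: continuous_expR.
apply: cvgB; first (apply: cvgM; first exact: cvg_cst).
- apply: cvg_sum => k; apply: cvgM => //.
  rewrite mulmx_colE; under eq_fun do rewrite mulmx_colE.
  by apply: cvg_sum => l; apply: cvgM => //; exact: cvg_cst.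
- by apply: cvg_sum => k; apply: cvgM => //; exact: cvg_cst.
Qed.

Hypothesis t0 : forall k, 0 < t k 0.
Variable e : R.
Hypothesis e0 : 0 < e.
Hypothesis Me : forall x : 'cV[R]_n,
  e * \sum_k x k 0 ^+ 2 <= \sum_k x k 0 * (M *m x) k 0.

Let gap k := 2 * t k 0 ^+ 2 / e.

(** For negative y_k the term - t_k y_k is enough; for positive y_k, use
expR y >= y, and complete the square in e y^2 / 2 - 2 t_k y. *)
Lemma potential_ge y : \sum_k (t k 0 * `|y k| - gap k) <= potential y.
Proof.
have : \sum_k (2^-1 * e * expR (y k) ^+ 2 - t k 0 * y k) <= potential y.
  rewrite sumrB lerB // -mulr_sumr -mulrA ler_pM2l ?invr_gt0 //.
  apply: le_trans (Me _); rewrite le_eqVlt; apply/orP; left; apply/eqP.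
  by congr (_ * _); apply: eq_bigr => k _; rewrite mxE.
apply: le_trans; apply: ler_sum => k _; rewrite /gap.
have [y0|y0] := ger0P (y k).
  have ey : y k ^+ 2 <= expR (y k) ^+ 2.
    rewrite lerXn2r ?nnegrE ?expR_ge0 //.
    by rewrite (le_trans _ (expR_ge1Dx _)) // lerDr.
  suff : 0 <= 2^-1 * e * (y k - 2 * t k 0 / e) ^+ 2.
    have -> : 2^-1 * e * (y k - 2 * t k 0 / e) ^+ 2 =
      2^-1 * e * y k ^+ 2 - 2 * t k 0 * y k + 2 * t k 0 ^+ 2 / e.
      by field; rewrite gt_eqF.
    have : e * y k ^+ 2 <= e * expR (y k) ^+ 2 by rewrite ler_pM2l.
    lra.
  by rewrite mulr_ge0 ?sqr_ge0 // mulr_ge0 ?invr_ge0 // ltW.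
have : 0 <= e * expR (y k) ^+ 2 by rewrite mulr_ge0 ?sqr_ge0 // ltW.
have : 0 <= 2 * t k 0 ^+ 2 / e by rewrite divr_ge0 ?mulr_ge0 ?sqr_ge0 // ltW.
lra.
Qed.

Hypothesis Msym : forall k l, M k l = M l k.

(** Multiply the coordinate x_k by u, that is, add ln u to y_k: the minimality
of y yields the hypothesis of [tangent_slope] with slope x_k (M x)_k. *)
Lemma potential_min_solution y : (forall z, potential y <= potential z) ->
  inv_set t M (expcv y).
Proof.
move=> ymin k; apply: (@tangent_slope _ _ (2^-1 * expR (y k) ^+ 2 * M k k)).
  exact: ltW.
move=> u u0.
have := ymin (fun l => y l + ln u *+ (l == k)).
set z := fun _ => _.
pose h := expR (y k) * (u - 1).
have zE : expcv z = expcv y + h *: delta_mx k 0.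
  apply/colP => l; rewrite !mxE eqxx andbT /z.
  case: eqVneq => [->|_]; last by rewrite !addr0 mulr0 addr0.
  by rewrite mulr1n expRD lnK ?posrE // /h mulr1; ring.
have zl l : expcv z l 0 = expcv y l 0 + h *+ (l == k).
  by rewrite zE [LHS]mxE [X in _ + X]mxE [X in _ * X]mxE eqxx andbT mulr_natr.
have Mz l : (M *m expcv z) l 0 = (M *m expcv y) l 0 + h * M l k.
  by rewrite zE mulmxDr -scalemxAr -colE !mxE.
have qz : \sum_l expcv z l 0 * (M *m expcv z) l 0 =
    \sum_l expcv y l 0 * (M *m expcv y) l 0
    + 2 * h * (M *m expcv y) k 0 + h ^+ 2 * M k k.
  rewrite (eq_bigr (fun l => expcv y l 0 * (M *m expcv y) l 0 +
    h * (M k l * expcv y l 0) + (h * (M *m expcv z) l 0) *+ (l == k))).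
    rewrite !big_split /= -mulr_sumr -mulmx_colE.
    rewrite [X in _ + X](bigD1 k) //= [X in _ + (_ + X)]big1 => [|l /negPf->//].
    by rewrite eqxx mulr1n addr0 Mz; ring.
  move=> l _; rewrite zl Mz [M k l]Msym.
  by case: (eqVneq l k) => [->|_]; rewrite ?mulr1n ?mulr0n; ring.
have tz : \sum_l t l 0 * z l = \sum_l t l 0 * y l + t k 0 * ln u.
  rewrite (eq_bigr (fun l => t l 0 * y l + (t k 0 * ln u) *+ (l == k))).
    rewrite big_split /= [X in _ + X](bigD1 k) //=.
    by rewrite [X in _ + (_ + X)]big1 => [|l /negPf->//]; rewrite eqxx addr0.
  move=> l _; rewrite /z mulrDr.
  by case: (eqVneq l k) => [->|_]; rewrite ?mulr1n ?mulr0n ?mulr0.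
rewrite /potential qz tz [expcv y k 0]mxE /h; lra.
Qed.

Lemma positive_solution : exists b : 'cV[R]_n,
  (forall k, 0 < b k 0) /\ inv_set t M b.
Proof.
have gap0 k : 0 <= gap k by rewrite divr_ge0 ?mulr_ge0 ?sqr_ge0 // ltW.
have [||y ymin] := @coercive_min R n potential (- \sum_k gap k) potential_cvg.
- move=> y; apply: le_trans (potential_ge y).
  by rewrite sumrB lerDr sumr_ge0 // => k _; rewrite mulr_ge0 // ltW.
- move=> C; exists (\sum_k (`|C| + \sum_l gap l) / t k 0) => y yC k.
  have C0 : 0 <= `|C| + \sum_l gap l by rewrite addr_ge0 // sumr_ge0.
  apply: (@le_trans _ _ ((`|C| + \sum_l gap l) / t k 0)); last first.
    rewrite [leRHS](bigD1 k) //= lerDl sumr_ge0 // => l _.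
    by rewrite divr_ge0 // ltW.
  rewrite ler_pdivlMr // mulrC -lerBlDr.
  apply: le_trans (le_trans yC (ler_norm _)).
  apply: le_trans (potential_ge y); rewrite sumrB lerD2r (bigD1 k) //= lerDl.
  by rewrite sumr_ge0 // => l _; rewrite mulr_ge0 // ltW.
exists (expcv y); split; first by move=> k; rewrite mxE expR_gt0.
exact: potential_min_solution.
Qed.

End Minimisation.

(** The orthants are indexed by the set of their negative coordinates, so that the
same finite type {set 'I_n} indexes solutions and square-free monomials. *)
Definition orthant_sign (R : realType) (n : nat) (s : {set 'I_n}) (k : 'I_n) : R :=
  (-1) ^+ (k \in s).

(** Conjugating M by the diagonal matrix of signs of an orthant maps the solutions
in that orthant to the positive ones. *)
Lemma orthant_solution (R : realType) (n : nat) (M : 'M[R]_n) (t : 'cV[R]_n)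
    (e : R) (s : {set 'I_n}) :
  (forall k, 0 < t k 0) -> 0 < e -> (forall k l, M k l = M l k) ->
  (forall x : 'cV[R]_n,
     e * \sum_k x k 0 ^+ 2 <= \sum_k x k 0 * (M *m x) k 0) ->
  exists b : 'cV[R]_n,
    (forall k, 0 < orthant_sign R s k * b k 0) /\ inv_set t M b.
Proof.
move=> t0 e0 Msym Me.
pose sg := @orthant_sign R n s.
have sg2 k : sg k * sg k = 1 by rewrite -expr2 sqrr_sign.
pose N := \matrix_(k, l) (sg k * sg l * M k l).
pose flip (x : 'cV[R]_n) := \col_k (sg k * x k 0).
have NE (x : 'cV[R]_n) k : (N *m x) k 0 = sg k * (M *m flip x) k 0.
  rewrite !mulmx_colE mulr_sumr; apply: eq_bigr => l _; rewrite !mxE; ring.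
have [||b [b0 bI]] := @positive_solution R n N t t0 e e0.
- move=> x; have := Me (flip x).
  rewrite (eq_bigr (fun k => x k 0 ^+ 2)) => [|k _]; last first.
    by rewrite mxE exprMn expr2 sg2 mul1r.
  move=> /le_trans; apply; rewrite le_eqVlt; apply/orP; left; apply/eqP.
  by apply: eq_bigr => k _; rewrite NE mxE; ring.
- by move=> k l; rewrite !mxE Msym; ring.
exists (flip b); split=> k; first by rewrite mxE mulrA sg2 mul1r.
by rewrite -bI NE mxE; ring.
Qed.

(** * Perturbation of a positive semidefinite matrix *)

Definition in_orthant (R : realType) (n : nat) (s : {set 'I_n}) (b : 'cV[R]_n) :=
  forall k, 0 < orthant_sign R s k * b k 0.

Lemma in_orthant_inj (R : realType) (n : nat) (s s' : {set 'I_n}) (b : 'cV[R]_n) :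
  in_orthant s b -> in_orthant s' b -> s = s'.
Proof.
move=> bs bs'; apply/setP => k; have := mulr_gt0 (bs k) (bs' k).
rewrite /orthant_sign mulrACA -signr_addb -expr2 => h.
by move: h; case: (k \in s); case: (k \in s') => //=; rewrite expr1 mulN1r oppr_gt0 ltNge sqr_ge0.
Qed.

Lemma symmetricmx_sym (R : fieldType) (n : nat) (M : 'M[R]_n) k l :
  M \is symmetricmx -> M k l = M l k.
Proof.
by move=> /is_hermitianmxP; rewrite expr0 scale1r => /matrixP/(_ k l); rewrite !mxE.
Qed.

Lemma sqr_cvg0 (R : realType) (T : Type) (F : set_system T) (u v : T -> R) :
  Filter F -> (\forall m \near F, u m ^+ 2 <= v m) -> v m @[m --> F] --> (0 : R) ->
  u m @[m --> F] --> (0 : R).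
Proof.
move=> FF uv v0.
have sv : Num.sqrt (v m) @[m --> F] --> (0 : R).
  by rewrite -[X in _ --> X]sqrtr0; apply: continuous_cvg v0; exact: sqrt_continuous.
apply: (@squeeze_cvgr _ _ _ _ (fun m => - Num.sqrt (v m)) (fun m => Num.sqrt (v m))) => //.
  by apply: filterS uv => m uvm; rewrite -ler_norml -sqrtr_sqr ler_wsqrtr.
by rewrite -[X in _ --> X]oppr0; apply: cvgN.
Qed.

Lemma perturb_mulE (R : nzRingType) (n : nat) (M : 'M[R]_n) (e : R) (b : 'cV[R]_n) k :
  ((M + e%:M) *m b) k 0 = (M *m b) k 0 + e * b k 0.
Proof. by rewrite mulmxDl mul_scalar_mx !mxE. Qed.

Lemma psd_perturb (R : realType) (n : nat) (M : 'M[R]_n) (e : R) :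
  psd M -> 0 <= e -> psd (M + e%:M).
Proof.
move=> Mpsd e0 x; rewrite mulmxDr mulmxDl mxE addr_ge0 //.
rewrite mul_mx_scalar -scalemxAl mxE mulr_ge0 // mxE sumr_ge0 // => k _.
by rewrite mxE -expr2 sqr_ge0.
Qed.

Section Perturbation.
Variables (R : realType) (n : nat) (M : 'M[R]_n) (t : 'cV[R]_n).
Hypothesis t0 : forall k, 0 < t k 0.
Hypothesis Mpsd : psd M.

Lemma inv_set_neq0 N b k : inv_set t N b -> b k 0 != 0.
Proof.
by move=> bI; apply: contraTneq (t0 k) => bk; rewrite -bI bk mul0r ltxx.
Qed.

(** On solutions (M p + e p)_k = t_k / p_k and (M b)_k = t_k / b_k.  Pairing the
difference with p - b, where (p - b)^T M (p - b) is nonnegative, gives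
sum_l t_l (p_l - b_l)^2 / (p_l b_l) <= e (b . p - |p|^2) <= e |b|^2 / 4, all terms
on the left being nonnegative because p and b have the same signs. *)
Lemma orthant_close (e : R) (s : {set 'I_n}) (p b : 'cV[R]_n) k :
  0 <= e -> in_orthant s p -> in_orthant s b ->
  inv_set t (M + e%:M) p -> inv_set t M b ->
  let eta := e * (\sum_l b l 0 ^+ 2) / (4 * t k 0) in
  eta <= 1 -> (p k 0 - b k 0) ^+ 2 <= 3 * b k 0 ^+ 2 * eta.
Proof.
move=> e0 ps bs pI bI eta eta1.
have pb0 l : 0 < p l 0 * b l 0.
  have := mulr_gt0 (ps l) (bs l).
  by rewrite mulrACA /orthant_sign -expr2 sqrr_sign mul1r.
pose g l := t l 0 * (p l 0 - b l 0) ^+ 2 / (p l 0 * b l 0).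
have g0 l : 0 <= g l.
  by rewrite divr_ge0 ?(ltW (pb0 l)) // mulr_ge0 ?sqr_ge0 // ltW.
have gE l : g l = - ((p - b) l 0 * (M *m (p - b)) l 0)
                  - e * (p l 0 * (p l 0 - b l 0)).
  have pl := inv_set_neq0 l pI; have bl := inv_set_neq0 l bI.
  have Mp : (M *m p) l 0 = t l 0 / p l 0 - e * p l 0.
    by rewrite -(pI l) perturb_mulE; field.
  have Mb : (M *m b) l 0 = t l 0 / b l 0 by rewrite -(bI l) mulrC mulKf.
  have MB : (M *m (p - b)) l 0 = (M *m p) l 0 - (M *m b) l 0.
    by rewrite mulmxBr mxE [X in _ + X]mxE.
  rewrite MB Mp Mb [(p - b) l 0]mxE [(- b) l 0]mxE /g.
  by field; rewrite pl bl.
have gsum : \sum_l g l <= e * (\sum_l b l 0 ^+ 2) / 4.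
  rewrite (eq_bigr _ (fun l _ => gE l)) sumrB sumrN -quadE.
  have := Mpsd (p - b); rewrite -mulr_sumr -mulrA.
  suff : e * - \sum_l (p l 0 * (p l 0 - b l 0)) <=
         e * ((\sum_l b l 0 ^+ 2) / 4) by lra.
  apply: ler_wpM2l => //; rewrite -sumrN mulr_suml; apply: ler_sum => l _.
  by have := sqr_ge0 (p l 0 - b l 0 / 2); lra.
have gk : g k <= e * (\sum_l b l 0 ^+ 2) / 4.
  by apply: le_trans gsum; rewrite (bigD1 k) //= lerDl sumr_ge0.
have eta0 : 0 <= eta.
  by rewrite divr_ge0 ?mulr_ge0 ?sumr_ge0 // => [l _|]; rewrite ?sqr_ge0 // ltW.
have d : (p k 0 - b k 0) ^+ 2 <= eta * (p k 0 * b k 0).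
  rewrite -ler_pdivrMr // -(ler_pM2l (t0 k)) /eta mulrA.
  apply: le_trans gk _; rewrite le_eqVlt; apply/orP; left; apply/eqP.
  by field; rewrite gt_eqF.
(* Here (p - b)^2 <= eta p b with eta <= 1, so p^2 <= 3 p b, hence p b <= 3 b^2. *)
suff : p k 0 * b k 0 <= 3 * b k 0 ^+ 2.
  by move=> h; apply: le_trans d _; rewrite mulrC ler_wpM2r.
rewrite -(ler_pM2l (pb0 k)).
have : p k 0 ^+ 2 <= 3 * (p k 0 * b k 0).
  have : eta * (p k 0 * b k 0) <= 1 * (p k 0 * b k 0) by rewrite ler_pM2r.
  have := sqr_ge0 (b k 0); move: d; nra.
by have := sqr_ge0 (b k 0); nra.
Qed.

Lemma orthant_unique (s : {set 'I_n}) (p b : 'cV[R]_n) :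
  in_orthant s p -> in_orthant s b -> inv_set t M p -> inv_set t M b -> p = b.
Proof.
move=> ps bs pI bI; apply/colP => k; apply/eqP.
have pI0 : inv_set t (M + 0%:M) p by rewrite raddf0 addr0.
have := orthant_close (k := k) (lexx 0) ps bs pI0 bI; rewrite /= !mul0r mulr0.
by move=> /(_ ler01); rewrite -subr_eq0 -sqrf_eq0 eq_le sqr_ge0 andbT.
Qed.

Hypothesis Msym : forall k l, M k l = M l k.
Hypothesis Mdiag : forall k, M k k = 1.
Hypothesis Mlt1 : forall k l, k != l -> `|M k l| < 1.

(* Since x / 0 = 0, the diagonal terms of D vanish: D is the sum of the bounds of
   [perturb_offdiag] over k <> l. *)
Let D := \sum_k \sum_l t k 0 * t l 0 / (1 - M k l ^+ 2).
Let E := (\sum_k t k 0 + \sum_(k < n) Num.sqrt D) ^+ 2 + D.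

Section Fixed.
Variable e : R.
Hypothesis e0 : 0 < e.
Local Notation N := (M + e%:M).

Lemma perturb_psd : psd N.
Proof. exact: psd_perturb (ltW e0). Qed.

Lemma perturb_entry k l : N k l = M k l + e *+ (k == l).
Proof. by rewrite !mxE. Qed.

Lemma perturb_solution (s : {set 'I_n}) :
  exists b : 'cV[R]_n, in_orthant s b /\ inv_set t N b.
Proof.
apply: (orthant_solution (e := e)) => // [k l|x].
  by rewrite !perturb_entry Msym eq_sym.
rewrite [leRHS](eq_bigr (fun k => x k 0 * (M *m x) k 0 + e * x k 0 ^+ 2)).
  by rewrite big_split -quadE /= -mulr_sumr lerDr.
by move=> k _; rewrite perturb_mulE; ring.
Qed.

Variable p : {set 'I_n} -> 'cV[R]_n.
Hypothesis ps : forall s, in_orthant s (p s).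
Hypothesis pI : forall s, inv_set t N (p s).

Local Notation c s := (weight t N (p s)).

Lemma perturb_moments S S' : pminor N S *
    \sum_s c s * (monom (p s) S * monom (p s) S') = (S == S')%:R * monom t S.
Proof.
apply: complete_moments => // [k|s s' pss|s].
- by rewrite gt_eqF.
- by apply: in_orthant_inj (ps s) _; rewrite pss.
- have := weight_gt0 (p s) perturb_psd t0; rewrite /weight -/(kernel_mx _ _ _ _).
  by apply: contraTneq => ->; rewrite invr0 mulr0 ltxx.
Qed.

Lemma perturb_sum : \sum_s c s = 1.
Proof.
have := perturb_moments finset.set0 finset.set0.
rewrite pminor0 eqxx !mul1r monom0 => <-.
by apply: eq_bigr => s _; rewrite monom0 !mulr1.
Qed.

Lemma perturb_covariance k l :
  (1 + e) * \sum_s c s * (p s k 0 * p s l 0) = t k 0 *+ (k == l).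
Proof.
have := perturb_moments [set k]%SET [set l]%SET.
rewrite pminor1 perturb_entry Mdiag eqxx mulr1n monom1 (inj_eq finset.set1_inj).
rewrite mulr_natl => <-; congr (_ * _).
by apply: eq_bigr => s _; rewrite !monom1.
Qed.

Lemma perturb_c_gt0 s : 0 < c s.
Proof. exact: weight_gt0 perturb_psd t0. Qed.

Lemma perturb_c_le1 s : c s <= 1.
Proof.
rewrite -perturb_sum (bigD1 s) //= lerDl sumr_ge0 // => s' _.
exact: ltW (perturb_c_gt0 _).
Qed.

(** The relation of [complete_moments] for S = S' = {k, l}, whose sum has only
nonnegative terms; the minor is (1 + e)^2 - m_kl^2 >= 1 - m_kl^2 > 0. *)
Lemma perturb_offdiag s k l : k != l ->
  c s * (p s k 0 * p s l 0) ^+ 2 <= t k 0 * t l 0 / (1 - M k l ^+ 2).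
Proof.
move=> kl; have M1 : 0 < 1 - M k l ^+ 2.
  by rewrite subr_gt0 -real_normK ?num_real // expr_lt1 // Mlt1.
rewrite ler_pdivlMr // mulrC.
have := perturb_moments [set k; l]%SET [set k; l]%SET.
rewrite pminor2 // eqxx mul1r monom2 // => <-.
rewrite !perturb_entry !Mdiag !eqxx !mulr1n [l == k]eq_sym (negPf kl) !mulr0n !addr0.
rewrite [M l k]Msym -expr2.
apply: ler_pM; first exact: ltW.
- by rewrite mulr_ge0 ?sqr_ge0 // ltW ?perturb_c_gt0.
- by have := ltW e0; nra.
rewrite (bigD1 s) //= monom2 // -expr2 lerDl sumr_ge0 // => s' _.
by rewrite monom2 // -expr2 mulr_ge0 ?sqr_ge0 // ltW ?perturb_c_gt0.
Qed.

Let D_ge k l : t k 0 * t l 0 / (1 - M k l ^+ 2) <= D.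
Proof.
have term0 i j : 0 <= t i 0 * t j 0 / (1 - M i j ^+ 2).
  rewrite divr_ge0 //; first by rewrite mulr_ge0 ?ltW.
  have [->|ij] := eqVneq i j.
    by rewrite Mdiag expr1n subrr lexx.
  by rewrite ltW // subr_gt0 -real_normK ?num_real // expr_lt1 // Mlt1.
rewrite /D (bigD1 k) //= (bigD1 l) //= -addrA lerDl addr_ge0 ?sumr_ge0 // => i _.
by rewrite sumr_ge0.
Qed.

(** For k = l, multiply p_k^2 <= t_k + sum over l <> k of |p_k p_l|, which follows
from the k-th equation, by the square root of the weight, and use the bound on
each product with l <> k. *)
Lemma perturb_bound s k l : c s * (p s k 0 * p s l 0) ^+ 2 <= E.
Proof.
have c0 := ltW (perturb_c_gt0 s).
have [kl|kl] := eqVneq k l; last first.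
  apply: le_trans (perturb_offdiag s kl) _; apply: le_trans (D_ge k l) _.
  by rewrite lerDr sqr_ge0.
rewrite -{l}kl.
have D0 : 0 <= D.
  have := D_ge k k; rewrite Mdiag expr1n subrr invr0 mulr0; exact.
apply: (@le_trans _ _ ((\sum_k t k 0 + \sum_(k < n) Num.sqrt D) ^+ 2)); last first.
  by rewrite lerDl.
pose r := Num.sqrt (c s).
have r0 : 0 <= r by exact: sqrtr_ge0.
have r1 : r <= 1 by rewrite -sqrtr1 ler_wsqrtr // perturb_c_le1.
have rr : r ^+ 2 = c s by rewrite sqr_sqrtr.
have rp0 : 0 <= r * (p s k 0 * p s k 0) by rewrite mulr_ge0 // -expr2 sqr_ge0.
have bound0 : 0 <= \sum_k t k 0 + \sum_(k < n) Num.sqrt D.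
  by rewrite addr_ge0 // sumr_ge0 // => i _; rewrite ?sqrtr_ge0 // ltW.
rewrite -rr -exprMn lerXn2r ?nnegrE //.
have pk : p s k 0 * p s k 0 <= t k 0 + \sum_(l | l != k) `|p s k 0 * p s l 0|.
  rewrite -[X in _ <= X + _](pI s) perturb_mulE mulmx_colE (bigD1 k) //= Mdiag mul1r.
  have : - \sum_(l | l != k) `|p s k 0 * p s l 0| <=
      \sum_(l | l != k) p s k 0 * (M k l * p s l 0).
    rewrite -sumrN; apply: ler_sum => l lk; rewrite lerNl mulrCA.
    apply: le_trans (ler_norm _) _; rewrite normrN normrM ler_piMl //.
    by rewrite ltW // Mlt1 // eq_sym.
  rewrite -mulr_sumr; have : 0 <= e * p s k 0 ^+ 2.
    by rewrite mulr_ge0 ?sqr_ge0 // ltW.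
  by move: (\sum_(l | _) M k l * _) (\sum_(l | _) `|_|) => a b; lra.
apply: le_trans (ler_wpM2l r0 pk) _; rewrite mulrDr; apply: lerD.
  apply: (@le_trans _ _ (t k 0)); first by rewrite ler_piMl // ltW.
  by rewrite (bigD1 k) //= lerDl sumr_ge0 // => i _; exact: ltW.
rewrite mulr_sumr big_mkcond /=; apply: ler_sum => l _.
case: ifP => [lk|_]; last exact: sqrtr_ge0.
rewrite -[leLHS]ger0_norm ?mulr_ge0 // -sqrtr_sqr ler_wsqrtr // exprMn rr.
rewrite real_normK ?num_real //; apply: le_trans (D_ge k l).
by apply: perturb_offdiag; rewrite eq_sym.
Qed.

End Fixed.

Lemma perturb_bounded : exists E : R, forall e : R, 0 < e ->
  forall p : {set 'I_n} -> 'cV[R]_n,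
  (forall s, in_orthant s (p s)) -> (forall s, inv_set t (M + e%:M) (p s)) ->
  forall s k l, weight t (M + e%:M) (p s) * (p s k 0 * p s l 0) ^+ 2 <= E.
Proof. by exists E => e e0 p ps pI s k l; exact: perturb_bound. Qed.

End Perturbation.

(** * Passage to the limit *)

Lemma cvg_det (R : realType) (n : nat) (T : Type) (F : set_system T)
    (A : T -> 'M[R]_n) (B : 'M[R]_n) : Filter F ->
  (forall i j, A m i j @[m --> F] --> B i j) -> \det (A m) @[m --> F] --> \det B.
Proof.
move=> FF AB; rewrite /determinant; apply: cvg_sum => s.
by apply: cvgM; [exact: cvg_cst | apply: cvg_prodr => i].
Qed.

Lemma cvg_weight (R : realType) (n : nat) (T : Type) (F : set_system T)
    (t b : 'cV[R]_n) (M : 'M[R]_n) (e : T -> R) (p : T -> 'cV[R]_n) : Filter F ->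
  \det (kernel_mx t M b b) != 0 -> e m @[m --> F] --> (0 : R) ->
  (forall k, p m k 0 @[m --> F] --> b k 0) ->
  weight t (M + (e m)%:M) (p m) @[m --> F] --> weight t M b.
Proof.
move=> FF d0 e0 pb; rewrite /weight; apply: cvgM; first exact: cvg_cst.
apply: cvgV => //; apply: cvg_det => i j.
rewrite -!/(kernel_mx _ _ _ _) kernel_mxE; under eq_fun do rewrite kernel_mxE !mxE.
apply: cvgD; first exact: cvg_cst.
apply: cvgM => //; apply: cvgM => //.
rewrite -[X in _ --> X]addr0; apply: cvgD; first exact: cvg_cst.
by case: eqVneq => _; [under eq_fun do rewrite mulr1n | exact: cvg_cst].
Qed.

Lemma fsbig_image_fin (V : nmodType) (I : finType) (J : choiceType)
    (P : pred I) (h : I -> J) (A : set J) (F : J -> V) :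
  (forall i, P i -> A (h i)) -> (forall j, A j -> exists2 i, P i & h i = j) ->
  {in P &, injective h} ->
  \sum_(j \in A) F j = \sum_(i | P i) F (h i).
Proof.
move=> PA AP hinj.
have -> : A = [set h i | i in [set` P]].
  by apply/seteqP; split=> [j /AP[i Pi <-]|_ [i Pi <-]]; [exists i | exact: PA].
rewrite fsbig_image; last by move=> i j; rewrite !inE => Pi Pj; apply: hinj.
by rewrite -(bigfs _ (index_enum_uniq I)) // => i _; rewrite mem_index_enum.
Qed.

Section Limit.
Variables (R : realType) (n : nat) (M : 'M[R]_n) (t : 'cV[R]_n).
Hypothesis t0 : forall k, 0 < t k 0.
Hypothesis Mpsd : psd M.
Hypothesis Msym : forall k l, M k l = M l k.
Hypothesis Mdiag : forall k, M k k = 1.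
Hypothesis Mlt1 : forall k l, k != l -> `|M k l| < 1.

Variables (U : set_system nat) (e : nat -> R).
Hypothesis UU : UltraFilter U.
Hypothesis e_gt0 : forall m, 0 < e m.
Hypothesis e_cvg0 : e m @[m --> U] --> (0 : R).
Variable p : nat -> {set 'I_n} -> 'cV[R]_n.
Hypothesis ps : forall m s, in_orthant s (p m s).
Hypothesis pI : forall m s, inv_set t (M + (e m)%:M) (p m s).

Local Notation c m s := (weight t (M + (e m)%:M) (p m s)).

Lemma det_kernel_mx_neq0 b : \det (kernel_mx t M b b) != 0.
Proof.
have := weight_gt0 b Mpsd t0; rewrite /weight -/(kernel_mx _ _ _ _).
by apply: contraTneq => ->; rewrite invr0 mulr0 ltxx.
Qed.

Lemma cvg_to_solution s b k : in_orthant s b -> inv_set t M b ->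
  p m s k 0 @[m --> U] --> b k 0.
Proof.
move=> bs bI.
pose eta m := e m * (\sum_l b l 0 ^+ 2) / (4 * t k 0).
have eta_cvg : eta m @[m --> U] --> (0 : R).
  rewrite /eta -[X in _ --> X](mul0r ((\sum_l b l 0 ^+ 2) / (4 * t k 0))).
  by under eq_fun do rewrite -mulrA; apply: cvgM => //; exact: cvg_cst.
suff : p m s k 0 - b k 0 @[m --> U] --> (0 : R).
  move=> d; rewrite -[X in _ --> X]add0r.
  under eq_fun do rewrite -[p _ s k 0](subrK (b k 0)).
  by apply: cvgD => //; exact: cvg_cst.
apply: (@sqr_cvg0 _ _ _ _ (fun m => 3 * b k 0 ^+ 2 * eta m)).
  apply: filterS (cvgr_le _ eta_cvg _ ltr01) => m eta1.
  exact: orthant_close (ltW (e_gt0 m)) (ps m s) bs (pI m s) bI eta1.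
rewrite -[X in _ --> X](mulr0 (3 * b k 0 ^+ 2)).
by apply: cvgM => //; exact: cvg_cst.
Qed.

(** If the weight has a limit l > 0, it is eventually at least l / 2, and
[perturb_bounded] with k = l bounds p_k^4 by 2 E / l.  So p converges along the
ultrafilter, to a point of the closed orthant that solves the limit system; its
coordinates are non-zero since the t_k are. *)
Lemma limit_solution s : ~ (c m s @[m --> U] --> (0 : R)) ->
  exists b, in_orthant s b /\ inv_set t M b.
Proof.
move=> c0.
have cge0 m : 0 < c m s by exact: perturb_c_gt0.
have cle1 m : c m s <= 1 by exact: (perturb_c_le1 t0 Mpsd (e_gt0 m) (ps m) (pI m)).
have [l cl] : exists l : R, c m s @[m --> U] --> l.
  apply: (@ultra_bounded_cvg _ _ _ _ 1) => //; apply: nearW => m.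
  by rewrite ger0_norm // ltW.
have lpos : 0 < l.
  rewrite lt_neqAle; apply/andP; split.
    by apply/eqP => l0; apply: c0; rewrite [X in _ --> X]l0.
  by apply: cvgr_to_ge cl _; apply: nearW => m; exact: ltW.
have [E Ebound] := perturb_bounded t0 Mpsd Msym Mdiag Mlt1.
have pbound k : \forall m \near U, `|p m s k 0| <= 1 + 2 * E / l.
  have l2 : l / 2 < l by lra.
  apply: filterS (cvgr_ge _ cl _ l2) => m lc.
  have h := Ebound _ (e_gt0 m) _ (ps m) (pI m) s k k.
  have {}h : (p m s k 0 * p m s k 0) ^+ 2 <= 2 * E / l.
    rewrite ler_pdivlMr //.
    have := sqr_ge0 (p m s k 0 * p m s k 0); move: (_ ^+ 2) h => q; nra.
  move: h; rewrite -expr2 -[p m s k 0 ^+ 2]real_normK ?num_real //.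
  have := normr_ge0 (p m s k 0); move: `|_| (2 * E / l) => x y x0 xy.
  have [x1|x1] := lerP x 1; first by have := sqr_ge0 (x ^+ 2); lra.
  by have : 0 <= x * (x * x * x - 1) ; [rewrite mulr_ge0 // | ]; nra.
have /choice[z zp] k : exists z : R, p m s k 0 @[m --> U] --> z.
  exact: ultra_bounded_cvg (pbound k).
pose b : 'cV[R]_n := \col_k z k.
have bI : inv_set t M b.
  move=> k; apply: (@cvg_unique _ (@Rhausdorff R)
    (p m s k 0 * ((M + (e m)%:M) *m p m s) k 0 @[m --> U])).
    apply: cvgM; first by rewrite mxE.
    rewrite -[X in _ --> X]addr0 -[X in _ + X](mul0r (z k)).
    under eq_fun do rewrite perturb_mulE.
    apply: cvgD; last exact: cvgM.
    rewrite mulmx_colE; under eq_fun do rewrite mulmx_colE.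
    by apply: cvg_sum => j; apply: cvgM; [exact: cvg_cst | rewrite mxE].
  have -> : (fun m => p m s k 0 * ((M + (e m)%:M) *m p m s) k 0) = (fun=> t k 0).
    by apply/funext => m; exact: pI.
  exact: cvg_cst.
exists b; split=> // k; rewrite lt_neqAle; apply/andP; split.
  by rewrite eq_sym mulf_neq0 ?signr_eq0 ?(inv_set_neq0 t0 k bI).
have : orthant_sign R s k * p m s k 0 @[m --> U] --> orthant_sign R s k * b k 0.
  by apply: cvgM; [exact: cvg_cst | rewrite mxE].
by move/cvgr_to_ge; apply; apply: nearW => m; exact: ltW (ps m s k).
Qed.

(** The set P consists of the orthants in which the limit system has a solution.
In the identities for M + e I, the terms of the other orthants tend to 0. *)
Lemma orthant_moments : exists sol : {set 'I_n} -> 'cV[R]_n, exists P : pred {set 'I_n},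
  [/\ forall s, P s -> in_orthant s (sol s) /\ inv_set t M (sol s),
      forall s b, in_orthant s b -> inv_set t M b -> P s /\ sol s = b,
      \sum_(s | P s) weight t M (sol s) = 1 &
      forall k l, \sum_(s | P s) weight t M (sol s) * (sol s k 0 * sol s l 0) =
        t k 0 *+ (k == l)].
Proof.
pose Q s (b : 'cV[R]_n) := in_orthant s b /\ inv_set t M b.
have /choice[sol solP] s : exists b, (exists b', Q s b') -> Q s b.
  have [[b Qb]|nb] := pselect (exists b', Q s b'); first by exists b.
  by exists 0 => /nb.
pose P s := `[< exists b', Q s b' >].
have PQ s : P s -> Q s (sol s) by move/asboolP/solP.
have cP s : P s -> c m s @[m --> U] --> weight t M (sol s).
  move=> /PQ[so sI]; apply: cvg_weight => //; first exact: det_kernel_mx_neq0.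
  by move=> k; exact: cvg_to_solution.
have cN s : ~~ P s -> c m s @[m --> U] --> (0 : R).
  move=> /asboolPn nP; have [//|/limit_solution //] :=
    pselect (c m s @[m --> U] --> (0 : R)).
have [E Ebound] := perturb_bounded t0 Mpsd Msym Mdiag Mlt1.
exists sol, P; split => //.
- move=> s b bs bI; have Ps : P s by apply/asboolP; exists b.
  by split=> //; have [so sI] := PQ s Ps; exact: (orthant_unique t0 Mpsd so bs sI bI).
- apply: (@cvg_unique _ (@Rhausdorff R) (\sum_s c m s @[m --> U])).
    rewrite big_mkcond; apply: cvg_sum => s.
    by case: ifPn => [/cP|/cN].
  have -> : (fun m => \sum_s c m s) = (fun=> 1).
    by apply/funext => m; exact: (perturb_sum t0 Mpsd (e_gt0 m) (ps m) (pI m)).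
  exact: cvg_cst.
- move=> k l.
  apply: (@cvg_unique _ (@Rhausdorff R)
    ((1 + e m) * \sum_s c m s * (p m s k 0 * p m s l 0) @[m --> U])).
    rewrite -[\sum_(s | _) _]mul1r -[X in X * \sum_(s | _) _]addr0.
    apply: cvgM; first by apply: cvgD => //; exact: cvg_cst.
    rewrite big_mkcond; apply: cvg_sum => s.
    case: ifPn => Ps.
      have [so sI] := PQ s Ps.
      by apply: cvgM; [exact: cP | apply: cvgM; exact: cvg_to_solution].
    apply: (@sqr_cvg0 _ _ _ _ (fun m => c m s * E)).
      apply: nearW => m; rewrite exprMn [_ ^+ 2 * _]mulrC expr2 mulrA mulrC.
      rewrite ler_pM2l ?(perturb_c_gt0 t0 Mpsd) // mulrC.
      exact: Ebound (e_gt0 m) _ (ps m) (pI m) s k l.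
    by rewrite -[X in _ --> X](mul0r E); apply: cvgM; [exact: cN | exact: cvg_cst].
  have -> : (fun m => (1 + e m) * \sum_s c m s * (p m s k 0 * p m s l 0)) =
      (fun=> t k 0 *+ (k == l)).
    apply/funext => m.
    exact: (perturb_covariance t0 Mpsd Mdiag (e_gt0 m) (ps m) (pI m)).
  exact: cvg_cst.
Qed.

End Limit.

Theorem theorem5 (R : realType) (n : nat) (hn : (2 <= n)%N) (M : 'M[R]_n)
  (hM : correlation_matrix M)
  (hM1 : forall k l : 'I_n, k != l -> `|M k l| < 1)
  (t : 'cV[R]_n) (ht : forall j : 'I_n, 0 < t j 0) :
  [/\ forall b : 'cV[R]_n, inv_set t M b -> 0 < weight t M b,
      \sum_(b \in inv_set t M) weight t M b = 1
    & \sum_(b \in inv_set t M) weight t M b *: tensor b b = diag_cv t].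
Proof.
have [Msym Mpsd Mdiag] := hM.
have Ms k l : M k l = M l k by exact: symmetricmx_sym.
have [U [UU oU]] := ultraFilterLemma (@eventually_filter).
pose e m : R := m.+1%:R^-1.
have e_gt0 m : 0 < e m by rewrite invr_gt0.
have e_cvg0 : e m @[m --> U] --> (0 : R).
  by apply: cvg_trans (@cvg_harmonic R); apply: cvg_app.
have /choice[p pP] m : exists p : {set 'I_n} -> 'cV[R]_n,
    forall s, in_orthant s (p s) /\ inv_set t (M + (e m)%:M) (p s).
  by have /choice[q qP] := perturb_solution ht Mpsd Ms (e_gt0 m); exists q.
have [sol [P [solP Psol sum1 sum2]]] := orthant_moments ht Mpsd Ms Mdiag hM1 UU e_gt0 e_cvg0
  (fun m s => proj1 (pP m s)) (fun m s => proj2 (pP m s)).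
have reindex (V : nmodType) (F : 'cV[R]_n -> V) :
    \sum_(b \in inv_set t M) F b = \sum_(s | P s) F (sol s).
  apply: fsbig_image_fin => [s /solP[]//|b bI|s s' /solP[ss _] /solP[ss' _] sols].
    pose s := [set k | b k 0 < 0]%SET.
    have bs : in_orthant s b.
      move=> k; rewrite /orthant_sign inE; have := inv_set_neq0 ht k bI.
      case: (ltrP (b k 0) 0) => b0 bk; first by rewrite expr1 mulN1r oppr_gt0.
      by rewrite expr0 mul1r lt_neqAle eq_sym bk.
    by exists s; [exact: (Psol s b bs bI).1 | exact: (Psol s b bs bI).2].
  by apply: in_orthant_inj ss _; rewrite sols.
split; first by move=> b _; exact: weight_gt0.
  by rewrite reindex.
rewrite reindex; apply/matrixP => k l.
rewrite summxE /diag_cv !mxE -sum2; apply: eq_bigr => s _.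
by rewrite !mxE big_ord1 !mxE.
Qed.
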